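(* The Nichols algebra $\mathfrak B(V_{2,3})$ is, as an algebra, the algebra generated by the elements $x=e_1$, $y=e_2$ subject to the relations $$x^2=0,\qquad xy-\xi yx=0,\qquad y^4=0.$$ In particular, $\dim\mathfrak B(V_{2,3})=8$.
   Context: $\Bbbk$ is an algebraically closed field of characteristic zero and $\xi\in\Bbbk$ is a fixed primitive $4$-th root of unity. $\mathcal K$ is the $8$-dimensional Hopf algebra over $\Bbbk$ generated as an algebra by $a,b,c,d$ with relations $ab=\xi ba$, $ac=\xi ca$, $cb=bc=0$, $cd=\xi dc$, $bd=\xi db$, $ad=da$, $ad=1$, $b^2=c^2=0$, $a^2c=b$, $a^4=1$, with $\Delta(a)=a\otimes a+b\otimes c$, $\Delta(b)=a\otimes b+b\otimes d$, $\Delta(c)=c\otimes a+d\otimes c$, $\Delta(d)=c\otimes b+d\otimes d$, $\varepsilon(a)=\varepsilon(d)=1$, $\varepsilon(b)=\varepsilon(c)=0$, $\mathcal S(a)=d$, $\mathcal S(b)=\xi b$, $\mathcal S(c)=-\xi c$, $\mathcal S(d)=a$. ${}^{\mathcal K}_{\mathcal K}\mathcal{YD}$ is the category of left Yetter-Drinfeld modules over $\mathcal K$: left modules and left comodules $M$ (coaction $\delta(m)=m_{(-1)}\otimes m_{(0)}$) with $\delta(h\cdot m)=h_{(1)}m_{(-1)}\mathcal S(h_{(3)})\otimes h_{(2)}\cdot m_{(0)}$; its braiding is $c_{M,N}(m\otimes n)=m_{(-1)}\cdot n\otimes m_{(0)}$. The Nichols algebra $\mathfrak B(V)$ is the (unique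 up to isomorphism) $\mathbb N$-graded braided Hopf algebra $R=\bigoplus_{n\ge0}R(n)$ in this category with $R(0)\simeq\Bbbk$, $R(1)\simeq V$, $R(1)$ equal to the space of primitive elements of $R$, and $R$ generated as an algebra by $R(1)$. For $i\in\mathbb Z_4$ and $\lambda=\xi^i$, $V_{i,3}\in{}^{\mathcal K}_{\mathcal K}\mathcal{YD}$ has basis $e_1,e_2$, action $a\cdot e_1=\lambda e_1$, $b\cdot e_1=c\cdot e_1=0$, $d\cdot e_1=\lambda^{-1}e_1$, $a\cdot e_2=-\xi\lambda e_2$, $b\cdot e_2=\lambda^2e_1$, $c\cdot e_2=e_1$, $d\cdot e_2=\xi\lambda^{-1}e_2$, and coaction $\delta(e_1)=a\otimes e_1+(\lambda^3+\xi\lambda)b\otimes e_2$, $\delta(e_2)=d\otimes e_2+\frac12(\lambda-\xi\lambda^3)c\otimes e_1$. Here $i=2$, $\lambda=-1$. *)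

(* Defs.v *)
From HB Require Import structures.
From mathcomp Require Import all_boot all_algebra.

Set Implicit Arguments.
Unset Strict Implicit.
Unset Printing Implicit Defensive.

Import GRing.Theory.
Local Open Scope ring_scope.

(* Elements of V (x) W are represented by finite lists of pairs: the list
   [:: (v_1, w_1); ...; (v_n, w_n)] stands for v_1 (x) w_1 + ... + v_n (x) w_n,
   and concatenation of lists is addition. Two lists denote the same tensor iff
   every bilinear map takes the same value on them, which is the universal
   property of V (x) W. Sweedler sums are then list comprehensions; tensors of
   rank three are lists of triples ((v, w), u). *)
Section Tensors.
Variables (k : fieldType) (V W U : lmodType k).

Definition teq2 (s t : seq (V * W)) : Prop :=
  forall (X : lmodType k) (f : V -> W -> X), bilinear_for *:%R *:%R f ->
    \sum_(p <- s) f p.1 p.2 = \sum_(p <- t) f p.1 p.2.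

Definition trilinear (X : lmodType k) (f : V -> W -> U -> X) : Prop :=
  [/\ forall w u, linear (fun v => f v w u),
      forall v u, linear (fun w => f v w u)
    & forall v w, linear (f v w)].

Definition teq3 (s t : seq (V * W * U)) : Prop :=
  forall (X : lmodType k) (f : V -> W -> U -> X), trilinear f ->
    \sum_(p <- s) f p.1.1 p.1.2 p.2 = \sum_(p <- t) f p.1.1 p.1.2 p.2.

Definition tlinear (f : U -> seq (V * W)) : Prop :=
  forall (a : k) (u v : U),
    teq2 (f (a *: u + v)) ([seq (a *: p.1, p.2) | p <- f u] ++ f v).

End Tensors.

Definition is_basis (k : fieldType) (V : lmodType k) (n : nat)
    (t : n.-tuple V) : Prop :=
  forall v : V, exists! c : 'rV[k]_n, v = \sum_i c 0 i *: tnth t i.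

Definition has_dim (k : fieldType) (V : lmodType k) (n : nat) : Prop :=
  exists t : n.-tuple V, is_basis t.

(* The algebra A is generated by the entries of g subject to the relations rel,
   expressed by the universal property of a presentation. *)
Definition presented (k : fieldType) (n : nat)
    (rel : forall B : algType k, n.-tuple B -> Prop)
    (A : algType k) (g : n.-tuple A) : Prop :=
  rel A g /\
  forall (B : algType k) (h : n.-tuple B), rel B h ->
    exists2 f : {lrmorphism A -> B}, map_tuple f g = h
      & forall f' : {lrmorphism A -> B}, map_tuple f' g = h -> f' =1 f.

Record coalgebra (k : fieldType) (C : lmodType k) := Coalgebra {
  cmul : C -> seq (C * C);
  counit : {scalar C};
  cmul_linear : tlinear cmul;
  cmul_coassoc : forall x,
    teq3 [seq (q.1, q.2, p.2) | p <- cmul x, q <- cmul p.1]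
         [seq (p.1, q.1, q.2) | p <- cmul x, q <- cmul p.2];
  counit_l : forall x, \sum_(p <- cmul x) counit p.1 *: p.2 = x;
  counit_r : forall x, \sum_(p <- cmul x) counit p.2 *: p.1 = x
}.

(* The iterated comultiplication h |-> h_(1) (x) h_(2) (x) h_(3). *)
Definition cmul3 (k : fieldType) (C : lmodType k) (D : coalgebra C) (x : C) :
    seq (C * C * C) :=
  [seq (q.1, q.2, p.2) | p <- cmul D x, q <- cmul D p.1].

Record hopf_algebra (k : fieldType) (K : algType k) := HopfAlgebra {
  hopf_coalgebra :> coalgebra K;
  antipode : {linear K -> K};
  hopf_cmul1 : teq2 (cmul hopf_coalgebra 1) [:: (1, 1)];
  hopf_cmulM : forall g h,
    teq2 (cmul hopf_coalgebra (g * h))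
         [seq (p.1 * q.1, p.2 * q.2)
            | p <- cmul hopf_coalgebra g, q <- cmul hopf_coalgebra h];
  hopf_counit1 : counit hopf_coalgebra 1 = 1;
  hopf_counitM : forall g h,
    counit hopf_coalgebra (g * h)
      = counit hopf_coalgebra g * counit hopf_coalgebra h;
  hopf_antipode_l : forall h,
    \sum_(p <- cmul hopf_coalgebra h) antipode p.1 * p.2
      = (counit hopf_coalgebra h)%:A;
  hopf_antipode_r : forall h,
    \sum_(p <- cmul hopf_coalgebra h) p.1 * antipode p.2
      = (counit hopf_coalgebra h)%:A
}.

(* Left Yetter-Drinfeld modules over the Hopf algebra K; the last field is
   delta(h . m) = h_(1) m_(-1) S(h_(3)) (x) h_(2) . m_(0). *)
Record yetter_drinfeld (k : fieldType) (K : algType k) (H : hopf_algebra K)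
    (M : lmodType k) := YetterDrinfeld {
  act : K -> M -> M;
  coact : M -> seq (K * M);
  act_bilinear : bilinear_for *:%R *:%R act;
  act1 : forall m, act 1 m = m;
  actM : forall g h m, act (g * h) m = act g (act h m);
  coact_linear : tlinear coact;
  coact_coassoc : forall m,
    teq3 [seq (q.1, q.2, p.2) | p <- coact m, q <- cmul H p.1]
         [seq (p.1, q.1, q.2) | p <- coact m, q <- coact p.2];
  coact_counit : forall m, \sum_(p <- coact m) counit H p.1 *: p.2 = m;
  yd_compat : forall h m,
    teq2 (coact (act h m))
         [seq (t.1.1 * p.1 * antipode H t.2, act t.1.2 p.2)
            | t <- cmul3 H h, p <- coact m]
}.

Record yd_morphism (k : fieldType) (K : algType k) (H : hopf_algebra K)
    (M N : lmodType k) (YM : yetter_drinfeld H M) (YN : yetter_drinfeld H N)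
    (f : {linear M -> N}) : Prop := YDMorphism {
  yd_morphism_act : forall h m, f (act YM h m) = act YN h (f m);
  yd_morphism_coact : forall m,
    teq2 (coact YN (f m)) [seq (p.1, f p.2) | p <- coact YM m]
}.

(* Hopf algebras in the braided category of Yetter-Drinfeld modules over K:
   all structure maps are morphisms of that category, where
   h . (r (x) s) = h_(1) . r (x) h_(2) . s and
   delta(r (x) s) = r_(-1) s_(-1) (x) r_(0) (x) s_(0), and the comultiplication
   is an algebra map into R (x) R, whose product is twisted by the braiding:
   (r (x) r')(s (x) s') = r (r'_(-1) . s) (x) r'_(0) s'. *)
Record braided_hopf (k : fieldType) (K : algType k) (H : hopf_algebra K)
    (R : algType k) := BraidedHopf {
  bh_yd :> yetter_drinfeld H R;
  bh_coalgebra : coalgebra R;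
  bh_antipode : {linear R -> R};

  bh_act_unit : forall h, act bh_yd h 1 = (counit H h)%:A;
  bh_act_mul : forall h r s,
    act bh_yd h (r * s)
      = \sum_(p <- cmul H h) act bh_yd p.1 r * act bh_yd p.2 s;
  bh_coact_unit : teq2 (coact bh_yd 1) [:: (1, 1)];
  bh_coact_mul : forall r s,
    teq2 (coact bh_yd (r * s))
         [seq (p.1 * q.1, p.2 * q.2) | p <- coact bh_yd r, q <- coact bh_yd s];

  bh_act_counit : forall h r,
    counit bh_coalgebra (act bh_yd h r) = counit H h * counit bh_coalgebra r;
  bh_act_cmul : forall h r,
    teq2 (cmul bh_coalgebra (act bh_yd h r))
         [seq (act bh_yd p.1 q.1, act bh_yd p.2 q.2)
            | p <- cmul H h, q <- cmul bh_coalgebra r];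
  bh_coact_counit : forall r,
    \sum_(p <- coact bh_yd r) counit bh_coalgebra p.2 *: p.1
      = (counit bh_coalgebra r)%:A;
  bh_coact_cmul : forall r,
    teq3 [seq (p.1, q.1, q.2) | p <- coact bh_yd r, q <- cmul bh_coalgebra p.2]
         [seq (uv.1.1 * uv.2.1, uv.1.2, uv.2.2)
            | p <- cmul bh_coalgebra r,
              uv <- [seq (u, v) | u <- coact bh_yd p.1, v <- coact bh_yd p.2]];

  bh_counit1 : counit bh_coalgebra 1 = 1;
  bh_counitM : forall r s,
    counit bh_coalgebra (r * s) = counit bh_coalgebra r * counit bh_coalgebra s;
  bh_cmul1 : teq2 (cmul bh_coalgebra 1) [:: (1, 1)];
  bh_cmulM : forall r s,
    teq2 (cmul bh_coalgebra (r * s))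
         [seq (pq.1.1 * act bh_yd u.1 pq.2.1, u.2 * pq.2.2)
            | pq <- [seq (p, q) | p <- cmul bh_coalgebra r,
                                  q <- cmul bh_coalgebra s],
              u <- coact bh_yd pq.1.2];

  bh_antipode_morphism : yd_morphism bh_yd bh_yd bh_antipode;
  bh_antipode_l : forall r,
    \sum_(p <- cmul bh_coalgebra r) bh_antipode p.1 * p.2
      = (counit bh_coalgebra r)%:A;
  bh_antipode_r : forall r,
    \sum_(p <- cmul bh_coalgebra r) p.1 * bh_antipode p.2
      = (counit bh_coalgebra r)%:A
}.

(* gr n is the homogeneous component R(n): R is the direct sum of the R(n) and
   all the structure of R respects this decomposition. *)
Record graded_braided_hopf (k : fieldType) (K : algType k)
    (H : hopf_algebra K) (R : algType k) (B : braided_hopf H R)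
    (gr : nat -> R -> Prop) : Prop := GradedBraidedHopf {
  gr_zero : forall n, gr n 0;
  gr_lin : forall n (a : k) r s, gr n r -> gr n s -> gr n (a *: r + s);
  gr_span : forall r, exists (N : nat) (f : nat -> R),
    (forall n, gr n (f n)) /\ r = \sum_(n < N) f n;
  gr_direct : forall (N : nat) (f : nat -> R), (forall n, gr n (f n)) ->
    \sum_(n < N) f n = 0 -> forall n, (n < N)%N -> f n = 0;
  gr_one : gr 0 1;
  gr_mul : forall m n r s, gr m r -> gr n s -> gr (m + n)%N (r * s);
  gr_act : forall n h r, gr n r -> gr n (act B h r);
  gr_coact : forall n r, gr n r ->
    exists2 s : seq (K * R), teq2 (coact B r) s
      & forall p, p \in s -> gr n p.2;
  gr_cmul : forall n r, gr n r ->
    exists2 s : seq (R * R), teq2 (cmul (bh_coalgebra B) r) s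
      & forall p, p \in s -> exists i j,
          [/\ (i + j)%N = n, gr i p.1 & gr j p.2];
  gr_counit : forall n r, (0 < n)%N -> gr n r -> counit (bh_coalgebra B) r = 0;
  gr_antipode : forall n r, gr n r -> gr n (bh_antipode B r)
}.

Definition primitive_elt (k : fieldType) (K : algType k) (H : hopf_algebra K)
    (R : algType k) (B : braided_hopf H R) (r : R) : Prop :=
  teq2 (cmul (bh_coalgebra B) r) [:: (r, 1); (1, r)].

(* R, graded by gr, is a Nichols algebra of the Yetter-Drinfeld module V, with
   V identified with R(1) through iota. *)
Record nichols_algebra (k : fieldType) (K : algType k) (H : hopf_algebra K)
    (V : lmodType k) (YV : yetter_drinfeld H V)
    (R : algType k) (B : braided_hopf H R)
    (gr : nat -> R -> Prop) (iota : {linear V -> R}) : Prop := NicholsAlgebra {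
  nichols_graded : graded_braided_hopf B gr;
  nichols_gr0 : forall r, gr 0 r <-> exists c : k, r = c%:A;
  nichols_iota_morphism : yd_morphism YV B iota;
  nichols_iota_inj : injective iota;
  nichols_gr1 : forall r, gr 1 r <-> exists v, r = iota v;
  nichols_primitive : forall r, gr 1 r <-> primitive_elt B r;
  nichols_generated : forall S : R -> Prop,
    S 1 -> (forall (a : k) r s, S r -> S s -> S (a *: r + s)) ->
    (forall r s, S r -> S s -> S (r * s)) -> (forall r, gr 1 r -> S r) ->
    forall r, S r
}.

Definition calK_rel (k : fieldType) (xi : k) (A : algType k)
    (g : 4.-tuple A) : Prop :=
  let a := tnth g 0 in let b := tnth g 1 in
  let c := tnth g 2 in let d := tnth g 3 in
  [/\ a * b = xi *: (b * a), a * c = xi *: (c * a), c * b = 0 & b * c = 0] /\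
  [/\ c * d = xi *: (d * c), b * d = xi *: (d * b), a * d = d * a
    & a * d = 1] /\
  [/\ b ^+ 2 = 0, c ^+ 2 = 0, a ^+ 2 * c = b & a ^+ 4 = 1].

Record is_calK (k : fieldType) (xi : k) (K : algType k) (H : hopf_algebra K)
    (a b c d : K) : Prop := IsCalK {
  calK_dim : has_dim K 8;
  calK_presented : presented (@calK_rel k xi) [tuple a; b; c; d];
  calK_cmul_a : teq2 (cmul H a) [:: (a, a); (b, c)];
  calK_cmul_b : teq2 (cmul H b) [:: (a, b); (b, d)];
  calK_cmul_c : teq2 (cmul H c) [:: (c, a); (d, c)];
  calK_cmul_d : teq2 (cmul H d) [:: (c, b); (d, d)];
  calK_counit : [/\ counit H a = 1, counit H d = 1, counit H b = 0
                  & counit H c = 0];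
  calK_antipode : [/\ antipode H a = d, antipode H b = xi *: b,
                      antipode H c = - xi *: c & antipode H d = a]
}.

(* The module V_{i,3}, with basis e1, e2 and lambda = xi ^ i. *)
Record is_V3 (k : fieldType) (xi : k) (K : algType k) (H : hopf_algebra K)
    (a b c d : K) (i : 'Z_4) (V : lmodType k) (Y : yetter_drinfeld H V)
    (e1 e2 : V) (lam := xi ^+ i) : Prop := IsV3 {
  V3_basis : is_basis [tuple e1; e2];
  V3_act_e1 : [/\ act Y a e1 = lam *: e1, act Y b e1 = 0, act Y c e1 = 0
                & act Y d e1 = lam^-1 *: e1];
  V3_act_e2 : [/\ act Y a e2 = (- xi * lam) *: e2,
                  act Y b e2 = lam ^+ 2 *: e1, act Y c e2 = e1
                & act Y d e2 = (xi * lam^-1) *: e2];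
  V3_coact_e1 : teq2 (coact Y e1)
    [:: (a, e1); ((lam ^+ 3 + xi * lam) *: b, e2)];
  V3_coact_e2 : teq2 (coact Y e2)
    [:: (d, e2); ((2%:R^-1 * (lam - xi * lam ^+ 3)) *: c, e1)]
}.

Definition nichols_V23_rel (k : fieldType) (xi : k) (A : algType k)
    (g : 2.-tuple A) : Prop :=
  let x := tnth g 0 in let y := tnth g 1 in
  [/\ x ^+ 2 = 0, x * y - xi *: (y * x) = 0 & y ^+ 4 = 0].

(* Main.v *)
From HB Require Import structures.
Require Import Defs.
From mathcomp Require Import all_boot all_algebra.
From mathcomp Require Import ring.
From Stdlib Require Import IndefiniteDescription.

Set Implicit Arguments.
Unset Strict Implicit.
Unset Printing Implicit Defensive.

Import GRing.Theory.
Local Open Scope ring_scope.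

(** Write x = e_1, y = e_2 inside the Nichols algebra R. The coactions of x and
    y and the actions of a, b, c, d on them determine the braiding, hence how
    the comultiplication Delta of R sees a product whose left factor is x or y:

      Delta(y s) = y s_1 (x) s_2 + d.s_1 (x) y s_2
                   + (xi - 1)/2 c.s_1 (x) x s_2,

    and a similar formula holds for Delta(x s) ([Delta_yM], [Delta_xM]).

    The relations hold because x^2, xy - xi yx and y^4 are primitive: expanding
    Delta with these formulas, all mixed terms cancel. The primitive elements of
    R are exactly those of degree one, whereas these elements have degree 2
    or 4, so they vanish ([nichols_primitive_eq0], [x_sqr], [xy_comm],
    [y_pow4]). The elements x and y generate R, so the relations imply that the
    eight monomials y^j x^i with j < 4 and i < 2 span R ([monomials_span]).

    For linear independence, let phi be the linear functional on R that is the
    coefficient of y on R(1) and vanishes on the other components, and let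
    D(r) = phi(r_2) r_1. The formula for Delta(y s) gives D(y s) = y D(s) + d.s,
    and d.(y^j x^i) = (-xi)^j (-1)^i y^j x^i, so that

      D(y^j x^i) = (-1)^i [j] y^(j-1) x^i,
      [j] = 1 + (-xi) + ... + (-xi)^(j-1).

    As [1], [2], [3] are nonzero, applying D to a vanishing combination of the
    monomials lowers the power of y, and one is reduced to the independence of
    1 and x, which lie in different degrees ([monomials_free]).

    Finally, an algebra that satisfies the three relations and in which the
    eight monomials form a basis is presented by the relations, because
    products of monomials are computed by the same rule in every algebra where
    the relations hold ([quantum_plane_presented]). *)

(** * Comparing linear combinations of given vectors *)

Section LinearCombination.
Variables (k : fieldType) (X : lmodType k) (t : seq X).

(** A list of pairs (e, i) stands for the sum of the vectors e t_i, so that an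
    equation between explicit linear combinations in a module can be replaced by
    one equation in the field for each vector t_i. *)
Definition lincomb_eval (s : seq (k * nat)) : X :=
  foldr (fun p v => p.1 *: t`_p.2 + v) 0 s.

Definition lincomb_coef (s : seq (k * nat)) (i : nat) : k :=
  foldr (fun p c => if p.2 == i then p.1 + c else c) 0 s.

Lemma eq_lincomb (s1 s2 : seq (k * nat)) :
  foldr (fun i P => lincomb_coef s1 i = lincomb_coef s2 i /\ P) True
    (iota 0 (size t)) ->
  lincomb_eval s1 = lincomb_eval s2.
Proof.
have collect s : lincomb_eval s = \sum_(i < size t) lincomb_coef s i *: t`_i.
  elim: s => [|[e j] s /= ->]; first by rewrite big1 // => i _; rewrite scale0r.
  have -> : t`_j = \sum_(i < size t) (if j == i then t`_i else 0).
    have [tj|jt] := leqP (size t) j.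
      by rewrite nth_default // big1 // => i _; rewrite gtn_eqF // (leq_trans _ tj).
    rewrite (bigD1 (Ordinal jt)) //= eqxx big1 ?addr0 // => i.
    by rewrite eq_sym -val_eqE /= => /negbTE->.
  rewrite scaler_sumr -big_split; apply: eq_bigr => i _ /=.
  by case: eqP => _; rewrite ?scalerDl // scaler0 add0r.
move=> h; rewrite !collect; apply: eq_bigr => i _; congr (_ *: _).
have /allP : {in iota 0 (size t), forall i, lincomb_coef s1 i == lincomb_coef s2 i}.
  elim: (iota _ _) h => [|j l IH] //= [/eqP h1 h2] i'.
  by rewrite inE => /orP[/eqP->|] //; apply: IH.
by move/allP=> /(_ i); rewrite mem_iota add0n ltn_ord => /(_ isT)/eqP.
Qed.
End LinearCombination.

(* Atoms are compared up to conversion: the same vector may carry different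
   but convertible structure instances. *)
Ltac atom_index env t :=
  match env with
  | ?t' :: _ => let _ := match goal with _ => unify t t' end in constr:(0%N)
  | _ :: ?env' => let n := atom_index env' t in constr:(S n)
  end.

Ltac reify_lincomb k env e :=
  lazymatch e with
  | ?e1 + ?e2 =>
      let l1 := reify_lincomb k env e1 in
      let l2 := reify_lincomb k env e2 in
      eval cbv [cat] in (l1 ++ l2)
  | - (?c *: ?t) => let i := atom_index env t in constr:([:: (- c, i)])
  | - ?t => let i := atom_index env t in constr:([:: (- 1%R : k, i)])
  | ?c *: ?t => let i := atom_index env t in constr:([:: (c, i)])
  | ?t => let i := atom_index env t in constr:([:: (1%R : k, i)])
  end.

(* Turns an equation between linear combinations of the vectors listed in env
   into the equations between their coefficients, in the order of env. *)
Ltac lincomb k env :=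
  lazymatch goal with
  | |- ?e1 = ?e2 =>
      let l1 := reify_lincomb k env e1 in
      let l2 := reify_lincomb k env e2 in
      have := @eq_lincomb k _ env l1 l2;
      rewrite /lincomb_eval /= ?scaleNr ?scale1r ?addr0 ?addrA;
      apply; rewrite /lincomb_coef /=; repeat split
  end.

(** * Bases and quantum plane monomials *)

Lemma basis_coordinates (k : fieldType) (V : lmodType k) n (t : n.-tuple V) :
  is_basis t ->
  exists co : {linear V -> 'rV[k]_n},
    (forall v, v = \sum_i co v 0 i *: tnth t i) /\
    (forall i, co (tnth t i) = delta_mx 0 i).
Proof.
move=> bt.
have ex v : exists c : 'rV[k]_n, v == \sum_i c 0 i *: tnth t i.
  by have [c [/eqP hc _]] := bt v; exists c.
pose co v := xchoose (ex v).
have coE v : v = \sum_i co v 0 i *: tnth t i by apply/eqP/(xchooseP (ex v)).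
have coU v (c : 'rV_n) : v = \sum_i c 0 i *: tnth t i -> co v = c.
  by move=> hc; have [c' [_ u]] := bt v; rewrite -(u _ (coE v)) -(u _ hc).
have co_lin : linear co.
  move=> a u v; apply: coU; rewrite {1}(coE u) {1}(coE v) scaler_sumr -big_split.
  by apply: eq_bigr => i _; rewrite !mxE scalerDl scalerA.
pose L := GRing.isLinear.Build k V 'rV[k]_n _ co co_lin.
exists (HB.pack_for {linear V -> 'rV[k]_n} co L); split=> //= i.
apply: coU; rewrite (bigD1 i) //= big1 ?addr0 => [|j ji]; rewrite mxE eqxx /=.
  by rewrite eqxx scale1r.
by rewrite (negbTE ji) scale0r.
Qed.

Section QuantumPlane.
Variables (k : fieldType) (q : k) (A : algType k) (x y : A).
Hypothesis xy : x * y = q *: (y * x).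

(** Moving each of the i factors x past each of the j factors y costs one
    factor q. *)
Lemma qcommute i j : x ^+ i * y ^+ j = q ^+ (i * j) *: (y ^+ j * x ^+ i).
Proof.
have xyj : x * y ^+ j = q ^+ j *: (y ^+ j * x).
  elim: j => [|j IH]; first by rewrite !expr0 mulr1 mul1r scale1r.
  rewrite (exprS y) mulrA xy -scalerAl -(mulrA y x) IH -scalerAr scalerA.
  by rewrite mulrA -!exprS.
elim: i => [|i IH]; first by rewrite mul0n !expr0 mulr1 mul1r scale1r.
rewrite (exprS x) -(mulrA x) IH -scalerAr (mulrA x) xyj -scalerAl scalerA.
by rewrite -(mulrA (y ^+ j)) -exprD mulSn addnC.
Qed.

Lemma qmonomialM i j i' j' :
  (y ^+ j * x ^+ i) * (y ^+ j' * x ^+ i')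
    = q ^+ (i * j') *: (y ^+ (j + j') * x ^+ (i + i')).
Proof.
rewrite mulrA -(mulrA (y ^+ j)) qcommute -scalerAr -scalerAl; congr (_ *: _).
by rewrite !exprD !mulrA.
Qed.
End QuantumPlane.

Definition qmonomials (k : fieldType) (A : algType k) (x y : A) : 8.-tuple A :=
  [tuple y ^+ (i %/ 2) * x ^+ (i %% 2) | i < 8].

Lemma sum_divmod2 (M : nmodType) (F : nat -> nat -> M) n :
  \sum_(m < n * 2) F (m %/ 2)%N (m %% 2)%N = \sum_(j < n) \sum_(l < 2) F j l.
Proof.
elim: n => [|n IH]; first by rewrite !big_ord0.
rewrite mulSn addnC addn2 !big_ord_recr IH big_ord0 /= add0r -addrA.
by rewrite -[(n * 2).+1]addn1 divnMDl // modnMDl mulnK // modnMl addn0.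
Qed.

Lemma qmonomial_cases (j i : nat) :
  (exists2 l : 'I_8, (l %/ 2)%N = j & (l %% 2)%N = i) \/ (4 <= j \/ 2 <= i)%N.
Proof.
have [j4|j4] := leqP 4 j; first by right; left.
have [i2|i2] := leqP 2 i; first by right; right.
left; have lt8 : (j * 2 + i < 8)%N.
  by case: j j4 => [|[|[|[|]]]] //; case: i i2 => [|[|]].
exists (Ordinal lt8) => /=; first by rewrite divnMDl // divn_small ?addn0.
by rewrite modnMDl modn_small.
Qed.

Lemma qmonomial_eq0 (k : fieldType) (A : algType k) (x y : A) (j i : nat) :
  x ^+ 2 = 0 -> y ^+ 4 = 0 -> (4 <= j \/ 2 <= i)%N -> y ^+ j * x ^+ i = 0.
Proof.
move=> x2 y4 [h|h].
  by rewrite -(subnK h) exprD y4 mulr0 mul0r.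
by rewrite -(subnK h) exprD x2 !mulr0.
Qed.

(** A basis leaves no choice but to send y^j x^i to Y^j X^i and to extend
    linearly. The result is multiplicative since, on both sides, the product of
    two monomials is the same power of xi times the monomial with the exponents
    added, and the monomials outside the basis vanish on both sides. *)
Lemma quantum_plane_presented (k : fieldType) (xi : k) (A : algType k)
    (g : 2.-tuple A) :
  nichols_V23_rel xi g -> is_basis (qmonomials (tnth g 0) (tnth g 1)) ->
  presented (@nichols_V23_rel k xi) g.
Proof.
set x := tnth g 0; set y := tnth g 1.
move=> relA bA; split=> // B h relB.
set X := tnth h 0; set Y := tnth h 1.
have [x2 /eqP xy y4] := relA; have [X2 /eqP XY Y4] := relB.
rewrite subr_eq0 in xy; rewrite subr_eq0 in XY.
move/eqP in xy; move/eqP in XY.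
have [co [coE coB]] := basis_coordinates bA.
pose f r := \sum_(i < 8) co r 0 i *: tnth (qmonomials X Y) i.
have f_lin : linear f.
  move=> a u v; rewrite /f scaler_sumr -big_split; apply: eq_bigr => i _.
  by rewrite linearP !mxE scalerDl scalerA.
pose FL := GRing.isLinear.Build k A B _ f f_lin.
pose fL : {linear A -> B} := HB.pack f FL.
have fmon j i : fL (y ^+ j * x ^+ i) = Y ^+ j * X ^+ i.
  have [[l <- <-]|h0] := qmonomial_cases j i; last first.
    by rewrite !qmonomial_eq0 // linear0.
  have -> : y ^+ (l %/ 2) * x ^+ (l %% 2) = tnth (qmonomials x y) l.
    by rewrite tnth_mktuple.
  rewrite /= /f coB (bigD1 l) //= big1 ?addr0 => [|j' jl]; rewrite mxE eqxx /=.
    by rewrite eqxx scale1r tnth_mktuple.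
  by rewrite (negbTE jl) scale0r.
have f1 : fL 1 = 1 by have := fmon 0 0; rewrite !expr0 !mulr1.
have fM : {morph fL : u v / u * v}.
  move=> u v; rewrite (coE u) (coE v) mulr_suml !linear_sum mulr_suml.
  apply: eq_bigr => i _; rewrite mulr_sumr linear_sum mulr_sumr.
  apply: eq_bigr => j _; rewrite -scalerAl -scalerAr scalerA !linearZ /=.
  rewrite -scalerAl -scalerAr scalerA; congr (_ *: _).
  rewrite !tnth_mktuple (qmonomialM xy).
  by rewrite [LHS](linearZ_LR fL) fmon !(fmon : forall j i, f _ = _) (qmonomialM XY).
pose FM := GRing.isMonoidMorphism.Build A B f (conj f1 fM).
pose fR : {lrmorphism A -> B} := HB.pack f FL FM.
have ext (f' : {lrmorphism A -> B}) : map_tuple f' g = h ->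
    f' x = X /\ f' y = Y.
  by rewrite /X /Y => <-; rewrite !tnth_map.
exists fR.
  apply: eq_from_tnth => i; rewrite tnth_map.
  have : (i == 0) || (i == 1) by case: i => [[|[|]]].
  case/orP=> /eqP->.
    by have := fmon 0 1; rewrite !expr0 !expr1 !mul1r.
  by have := fmon 1 0; rewrite !expr0 !expr1 !mulr1.
move=> f' /ext[fx fy] r; rewrite (coE r) !linear_sum; apply: eq_bigr => i _.
rewrite !linearZ; congr (_ *: _); rewrite tnth_mktuple rmorphM !rmorphXn /= fx fy.
by rewrite [RHS]fmon.
Qed.

(** * Comultiplication of a product with a primitive left factor *)

Local Notation bilinear f := (bilinear_for *:%R *:%R f).

Section Bilinear.
Variables (k : fieldType) (U V X : lmodType k) (f : U -> V -> X).
Hypothesis bf : bilinear f.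

Lemma bilZl a u v : f (a *: u) v = a *: f u v.
Proof. exact: (scalable_linear (bf.1 v)). Qed.
Lemma bilZr a u v : f u (a *: v) = a *: f u v.
Proof. exact: (scalable_linear (bf.2 u)). Qed.
Lemma bilDl u u' v : f (u + u') v = f u v + f u' v.
Proof. by have := bf.1 v 1 u u'; rewrite /= !scale1r. Qed.
Lemma bilDr u v v' : f u (v + v') = f u v + f u v'.
Proof. by have := bf.2 u 1 v v'; rewrite /= !scale1r. Qed.
Lemma bil0l v : f 0 v = 0.
Proof. by rewrite -(scale0r 0) bilZl scale0r. Qed.
Lemma bil0r u : f u 0 = 0.
Proof. by rewrite -(scale0r 0) bilZr scale0r. Qed.
Lemma bilNl u v : f (- u) v = - f u v.
Proof. by rewrite -scaleN1r bilZl scaleN1r. Qed.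
End Bilinear.

Section BraidedHopf.
Variables (k : fieldType) (K : algType k) (H : hopf_algebra K).
Variables (R : algType k) (B : braided_hopf H R).
Local Notation Delta := (cmul (bh_coalgebra B)).

Lemma act_linl (r : R) : linear (act B ^~ r).
Proof. exact: (act_bilinear B).1. Qed.
Lemma act_linr h : linear (act B h).
Proof. exact: (act_bilinear B).2. Qed.
Lemma actZl e h (r : R) : act B (e *: h) r = e *: act B h r.
Proof. exact: (bilZl (act_bilinear B)). Qed.
Lemma act0r h : act B h (0 : R) = 0.
Proof. exact: (bil0r (act_bilinear B)). Qed.

Lemma act_mulE h L (r s : R) : teq2 (cmul H h) L ->
  act B h (r * s) = \sum_(p <- L) act B p.1 r * act B p.2 s.
Proof.
move=> hL; rewrite bh_act_mul; apply: (hL R (fun g g' => act B g r * act B g' s)).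
split=> g a u v /=; first by rewrite act_linl mulrDl scalerAl.
by rewrite act_linl mulrDr scalerAr.
Qed.

Lemma Delta_linear (X : lmodType k) (f : R -> R -> X) a u v : bilinear f ->
  \sum_(p <- Delta (a *: u + v)) f p.1 p.2
    = a *: \sum_(p <- Delta u) f p.1 p.2 + \sum_(p <- Delta v) f p.1 p.2.
Proof.
move=> bf; rewrite (cmul_linear (bh_coalgebra B) a u v bf) big_cat big_map /=.
by congr (_ + _); rewrite scaler_sumr; apply: eq_bigr => p _; rewrite bilZl.
Qed.

(** This bilinear map computes Delta(y s) from Delta(s); its bilinearity
    allows the next lemma to be iterated. *)
Lemma bilinear_twist (y : R) L (X : lmodType k) (f : R -> R -> X) :
  bilinear f ->
  bilinear (fun p q => f (y * p) q + \sum_(u <- L) f (act B u.1 p) (u.2 * q)).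
Proof.
move=> bf; split=> [r' | r] a u v /=; rewrite scalerDr addrACA.
  rewrite mulrDr -scalerAr bf.1; congr (_ + _); rewrite scaler_sumr -big_split.
  by apply: eq_bigr => p _; rewrite act_linr bf.1.
rewrite bf.2; congr (_ + _); rewrite scaler_sumr -big_split.
by apply: eq_bigr => p _; rewrite mulrDr -scalerAr bf.2.
Qed.

(** Only Delta(y) = y (x) 1 + 1 (x) y enters. Its first term, having 1 on the
    right, meets a trivial braiding and yields y s_1 (x) s_2; in the second term
    y is braided past s_1, which yields y_(-1).s_1 (x) y_(0) s_2, where L lists
    the pairs (y_(-1), y_(0)). *)
Lemma Delta_primitive_mul (y s : R) L (X : lmodType k) (f : R -> R -> X) :
  primitive_elt B y -> teq2 (coact B y) L -> bilinear f ->
  \sum_(p <- Delta (y * s)) f p.1 p.2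
    = \sum_(p <- Delta s)
        (f (y * p.1) p.2 + \sum_(u <- L) f (act B u.1 p.1) (u.2 * p.2)).
Proof.
move=> prim_y coy bf.
have bg (r p1 p2 : R) : bilinear (fun g r' => f (r * act B g p1) (r' * p2)).
  split=> u a v w /=; last by rewrite mulrDl -scalerAl bf.2.
  by rewrite act_linl mulrDr -scalerAr bf.1.
rewrite (bh_cmulM B y s bf) big_allpairs_dep big_allpairs_dep /=.
pose G r r' := \sum_(q <- Delta s) \sum_(u <- coact B r')
                 f (r * act B u.1 q.1) (u.2 * q.2).
have bG : bilinear G.
  split=> [r' | r] a u v; rewrite /G /= scaler_sumr -big_split; apply: eq_bigr => q _ /=.
    rewrite scaler_sumr -big_split; apply: eq_bigr => p _ /=.
    by rewrite mulrDl -scalerAl bf.1.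
  rewrite (coact_linear B a u v (bg r q.1 q.2)) big_cat big_map scaler_sumr.
  congr (_ + _); apply: eq_bigr => p _ /=.
  exact: (bilZl (bg r q.1 q.2)).
rewrite [LHS](prim_y X G bG) !big_cons big_nil addr0 -big_split /=.
apply: eq_bigr => q _; rewrite (bh_coact_unit B (bg y q.1 q.2)) (coy _ _ (bg 1 q.1 q.2)).
rewrite big_cons big_nil addr0 act1 mul1r; congr (_ + _).
by apply: eq_bigr => u _; rewrite mul1r.
Qed.
End BraidedHopf.

(** * Homogeneous components and primitive elements *)

Section Graded.
Variables (k : fieldType) (K : algType k) (H : hopf_algebra K).
Variables (R : algType k) (B : braided_hopf H R) (gr : nat -> R -> Prop).
Hypothesis grB : graded_braided_hopf B gr.

(** The bound N records that f vanishes beyond it, so that decompositions of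
    different lengths can be added. *)
Definition decomposes (r : R) (f : nat -> R) : Prop :=
  exists N, [/\ forall n, gr n (f n), forall n, (N <= n)%N -> f n = 0
              & r = \sum_(n < N) f n].

Lemma decomposes_exists r : exists f, decomposes r f.
Proof.
have [N [f [grf ->]]] := gr_span grB r.
exists (fun n => if (n < N)%N then f n else 0); exists N; split.
- by move=> n; case: ifP => // _; apply: (gr_zero grB).
- by move=> n; rewrite leqNgt => /negbTE->.
- by apply: eq_bigr => n _; rewrite ltn_ord.
Qed.

Lemma decomposes_homogeneous n r : gr n r ->
  decomposes r (fun m => if m == n then r else 0).
Proof.
move=> grr; exists n.+1; split.
- by move=> m; case: eqP => [->|] // _; apply: (gr_zero grB).
- by move=> m; case: eqP => [->|] //; rewrite ltnn.
- rewrite (bigD1 ord_max) //= eqxx big1 ?addr0 // => m.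
  by rewrite -val_eqE /= => /negbTE->.
Qed.

Lemma decomposes_lin a r s f g : decomposes r f -> decomposes s g ->
  decomposes (a *: r + s) (fun n => a *: f n + g n).
Proof.
move=> [N [grf f0 ->]] [M [grg g0 ->]]; exists (maxn N M); split.
- by move=> n; apply: (gr_lin grB).
- by move=> n; rewrite geq_max => /andP[/f0-> /g0->]; rewrite scaler0 addr0.
have widen L h : (L <= maxn N M)%N -> (forall n, (L <= n)%N -> h n = 0 :> R) ->
    \sum_(n < L) h n = \sum_(n < maxn N M) h n.
  move=> le h0; rewrite (big_ord_widen _ _ le) big_mkcond.
  by apply: eq_bigr => n _; case: ltnP => // /h0.
rewrite (widen N f (leq_maxl _ _) f0) (widen M g (leq_maxr _ _) g0).
by rewrite big_split scaler_sumr.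
Qed.

Lemma decomposes0 f : decomposes 0 f -> forall n, f n = 0.
Proof.
move=> [N [grf f0 s0]] n; have [/f0//|nN] := leqP N n.
exact: (gr_direct grB grf (esym s0)).
Qed.

Lemma gr_disjoint m n r : gr m r -> gr n r -> m != n -> r = 0.
Proof.
move=> /decomposes_homogeneous dm /decomposes_homogeneous dn mn.
have := decomposes_lin (-1) dm dn; rewrite scaleN1r addNr => /decomposes0/(_ m).
by rewrite eqxx (negbTE mn) addr0 scaleN1r => /eqP; rewrite oppr_eq0 => /eqP.
Qed.

(** The degree-one part of an element is unique because R is the direct sum of
    its components, and it depends linearly on the element because
    decompositions can be combined linearly. Homogeneity is an arbitrary
    proposition, so selecting this part requires a choice principle. *)
Lemma degree_one_projection (V : lmodType k) (iota : {linear V -> R}) :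
  injective iota -> (forall r, gr 1 r <-> exists v, r = iota v) ->
  exists pr : {linear R -> V}, (forall v, pr (iota v) = v) /\
    (forall n r, gr n r -> n != 1 -> pr r = 0).
Proof.
move=> inj gr1.
pose P r v := exists2 f, decomposes r f & f 1 = iota v.
have exP r : exists v, P r v.
  have [f df] := decomposes_exists r; have [N [grf _ _]] := df.
  by have [v fv] := (gr1 _).1 (grf 1%N); exists v, f.
have P_lin a r s u v : P r u -> P s v -> P (a *: r + s) (a *: u + v).
  move=> [f df f1] [g dg g1]; exists (fun n => a *: f n + g n).
    exact: decomposes_lin.
  by rewrite f1 g1 linearP.
have P_fun r u v : P r u -> P r v -> u = v.
  move=> ru rv; have [f df f1] := P_lin (-1) _ _ _ _ ru rv.
  rewrite scaleN1r addNr in df; apply/esym/eqP; rewrite -subr_eq0 addrC -scaleN1r.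
  by rewrite -(inj_eq inj) linear0 -f1 (decomposes0 df).
pose pr r := sval (constructive_indefinite_description _ (exP r)).
have prP r : P r (pr r) := svalP (constructive_indefinite_description _ (exP r)).
have pr_lin : linear pr.
  by move=> a r s; apply: P_fun (prP _) _; apply: P_lin; apply: prP.
pose L := GRing.isLinear.Build k R V _ pr pr_lin.
exists (HB.pack_for {linear R -> V} pr L); split=> [v | n r grr n1] /=.
  apply: P_fun (prP _) _; exists (fun m => if m == 1%N then iota v else 0).
    by apply: decomposes_homogeneous; apply/gr1; exists v.
  by rewrite eqxx.
apply: P_fun (prP _) _; exists (fun m => if m == n then r else 0).
  exact: decomposes_homogeneous.
by rewrite eq_sym (negbTE n1) linear0.
Qed.
End Graded.

Lemma nichols_primitive_eq0 (k : fieldType) (K : algType k)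
    (H : hopf_algebra K) (V : lmodType k) (YV : yetter_drinfeld H V)
    (R : algType k) (B : braided_hopf H R) (gr : nat -> R -> Prop)
    (iota : {linear V -> R}) (nR : nichols_algebra YV B gr iota) n r :
  gr n r -> n != 1%N -> primitive_elt B r -> r = 0.
Proof.
move=> grn n1 /(nichols_primitive nR) gr1.
exact: (gr_disjoint (nichols_graded nR) grn gr1).
Qed.

(** * The action and coaction on the generators *)
Section NicholsV23.
Variables (k : closedFieldType) (xi : k).
Hypothesis char0 : [pchar k] =i pred0.
Hypothesis xi_prim : 4.-primitive_root xi.
Variables (K : algType k) (H : hopf_algebra K) (a b c d : K).
Hypothesis isK : is_calK xi H a b c d.
Variables (V : lmodType k) (YV : yetter_drinfeld H V) (e1 e2 : V).
Hypothesis isV : is_V3 xi a b c d (2 : 'Z_4) YV e1 e2.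
Variables (R : algType k) (B : braided_hopf H R) (gr : nat -> R -> Prop).
Variable iota : {linear V -> R}.
Hypothesis nR : nichols_algebra YV B gr iota.

Local Notation Delta := (cmul (bh_coalgebra B)).
Local Notation x := (iota e1).
Local Notation y := (iota e2).
Local Notation gam := (2%:R^-1 * (xi - 1)).

Lemma xi_sqr : xi ^+ 2 = -1.
Proof.
have x4 := prim_expr_order xi_prim.
have : (xi ^+ 2 - 1) * (xi ^+ 2 + 1) = 0 by rewrite -[RHS](subrr 1) -{3}x4; ring.
move/eqP; rewrite mulf_eq0 subr_eq0 addr_eq0 => /orP[/eqP x2|/eqP//].
by have := prim_order_dvd xi_prim 2; rewrite x2 eqxx.
Qed.

Lemma two_neq0 : 2%:R != 0 :> k.
Proof. by have /pcharf0P-> := char0. Qed.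

(** The parameter lambda = xi^i of V_{i,3}, for i = 2. *)
Lemma xi_exp_i : xi ^+ (2%R : 'Z_4) = -1. Proof. exact: xi_sqr. Qed.

Lemma act_iota h v : act B h (iota v) = iota (act YV h v).
Proof. by rewrite (yd_morphism_act (nichols_iota_morphism nR)). Qed.

Lemma act_x : [/\ act B a x = - x, act B b x = 0, act B c x = 0 & act B d x = - x].
Proof.
have := V3_act_e1 isV; rewrite xi_exp_i invrN invr1 !scaleN1r => -[ha hb hc hd].
by rewrite !act_iota ha hb hc hd linear0 linearN.
Qed.

Lemma act_y :
  [/\ act B a y = xi *: y, act B b y = x, act B c y = x & act B d y = - xi *: y].
Proof.
have := V3_act_e2 isV; rewrite xi_exp_i invrN invr1 sqrrN expr1n !mulrN1 opprK.
rewrite scale1r => -[ha hb hc hd].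
by rewrite !act_iota ha hb hc hd !linearZ.
Qed.

Lemma act_one :
  [/\ act B a 1 = 1, act B b 1 = 0, act B c 1 = 0 & act B d 1 = 1].
Proof.
have [ha hd hb hc] := calK_counit isK.
by rewrite !bh_act_unit ha hb hc hd scale1r scale0r.
Qed.

Lemma act_aM r s : act B a (r * s) = act B a r * act B a s + act B b r * act B c s.
Proof. by rewrite (act_mulE B _ _ (calK_cmul_a isK)) !big_cons big_nil addr0. Qed.
Lemma act_bM r s : act B b (r * s) = act B a r * act B b s + act B b r * act B d s.
Proof. by rewrite (act_mulE B _ _ (calK_cmul_b isK)) !big_cons big_nil addr0. Qed.
Lemma act_cM r s : act B c (r * s) = act B c r * act B a s + act B d r * act B c s.
Proof. by rewrite (act_mulE B _ _ (calK_cmul_c isK)) !big_cons big_nil addr0. Qed.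
Lemma act_dM r s : act B d (r * s) = act B c r * act B b s + act B d r * act B d s.
Proof. by rewrite (act_mulE B _ _ (calK_cmul_d isK)) !big_cons big_nil addr0. Qed.

Lemma coact_iota v L : teq2 (coact YV v) L ->
  teq2 (coact B (iota v)) [seq (p.1, iota p.2) | p <- L].
Proof.
move=> hL X f bf; rewrite (yd_morphism_coact (nichols_iota_morphism nR) v bf).
rewrite !big_map /=; apply: (hL X (fun g w => f g (iota w))).
by split=> [w | g] u v1 v2 /=; rewrite ?linearP bf.1 || rewrite linearP bf.2.
Qed.

Lemma coact_x : teq2 (coact B x) [:: (a, x); ((- (1 + xi)) *: b, y)].
Proof.
have := coact_iota (V3_coact_e1 isV); rewrite xi_exp_i.
by rewrite exprS sqrrN expr1n mulr1 mulrN1 -opprD.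
Qed.

Lemma coact_y : teq2 (coact B y) [:: (d, y); (gam *: c, x)].
Proof.
have := coact_iota (V3_coact_e2 isV); rewrite xi_exp_i.
by rewrite [X in xi * X]exprS sqrrN expr1n mulr1 mulrN1 opprK addrC.
Qed.

Lemma iota_primitive v : primitive_elt B (iota v).
Proof. by apply/(nichols_primitive nR)/(nichols_gr1 nR); exists v. Qed.

Lemma gr_iota v : gr 1 (iota v).
Proof. by apply/(nichols_gr1 nR); exists v. Qed.

(** * Coproducts of words in the generators *)

Section Coproduct.
Variables (X : lmodType k) (f : R -> R -> X).
Hypothesis bf : bilinear f.

Lemma Delta_iota v : \sum_(p <- Delta (iota v)) f p.1 p.2 = f (iota v) 1 + f 1 (iota v).
Proof. by rewrite (iota_primitive v bf) !big_cons big_nil addr0. Qed.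

Definition twist_x p q :=
  f (x * p) q + (f (act B a p) (x * q) - (1 + xi) *: f (act B b p) (y * q)).

Definition twist_y p q :=
  f (y * p) q + (f (act B d p) (y * q) + gam *: f (act B c p) (x * q)).

Lemma twist_xE p q : f (x * p) q +
  \sum_(u <- [:: (a, x); ((- (1 + xi)) *: b, y)]) f (act B u.1 p) (u.2 * q)
  = twist_x p q.
Proof. by rewrite !big_cons big_nil addr0 /= actZl (bilZl bf) scaleNr. Qed.

Lemma twist_yE p q : f (y * p) q +
  \sum_(u <- [:: (d, y); (gam *: c, x)]) f (act B u.1 p) (u.2 * q)
  = twist_y p q.
Proof. by rewrite !big_cons big_nil addr0 /= actZl (bilZl bf). Qed.

Lemma twist_x_bilinear : bilinear twist_x.
Proof.
have [h1 h2] := bilinear_twist B x [:: (a, x); ((- (1 + xi)) *: b, y)] bf.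
by split=> u e v w; have := h1 u e v w; have := h2 u e v w; rewrite /= !twist_xE.
Qed.

Lemma twist_y_bilinear : bilinear twist_y.
Proof.
have [h1 h2] := bilinear_twist B y [:: (d, y); (gam *: c, x)] bf.
by split=> u e v w; have := h1 u e v w; have := h2 u e v w; rewrite /= !twist_yE.
Qed.

Lemma Delta_xM s :
  \sum_(p <- Delta (x * s)) f p.1 p.2 = \sum_(p <- Delta s) twist_x p.1 p.2.
Proof.
rewrite (Delta_primitive_mul s (iota_primitive e1) coact_x bf).
by apply: eq_bigr => p _; rewrite twist_xE.
Qed.

Lemma Delta_yM s :
  \sum_(p <- Delta (y * s)) f p.1 p.2 = \sum_(p <- Delta s) twist_y p.1 p.2.
Proof.
rewrite (Delta_primitive_mul s (iota_primitive e2) coact_y bf).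
by apply: eq_bigr => p _; rewrite twist_yE.
Qed.
End Coproduct.

(** The braiding maps x (x) x to -x (x) x, which cancels the mixed term. *)
Lemma x_sqr : x ^+ 2 = 0.
Proof.
have [ax bx _ _] := act_x; have [a1 b1 _ _] := act_one.
have gr2 : gr 2 (x ^+ 2) := gr_mul (nichols_graded nR) (gr_iota e1) (gr_iota e1).
apply: (nichols_primitive_eq0 nR gr2) => // X f bf.
rewrite expr2 (Delta_xM bf) (Delta_iota (twist_x_bilinear bf)) !big_cons big_nil addr0.
rewrite /twist_x /= ax bx a1 b1 !mulr1 (bilNl bf) !(bil0l bf) !scaler0 !subr0.
by rewrite addrA subrK.
Qed.

(** The mixed terms of Delta(xy) are xi (y (x) x - x (x) y), those of Delta(yx)
    are y (x) x - x (x) y. *)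
Lemma xy_comm : x * y = xi *: (y * x).
Proof.
have [ax bx cx dx] := act_x; have [a1 b1 c1 d1] := act_one.
have [ay byy cy dy] := act_y.
have gxy := gr_mul (nichols_graded nR) (gr_iota e1) (gr_iota e2).
have gyx := gr_mul (nichols_graded nR) (gr_iota e2) (gr_iota e1).
have gr2 := gr_lin (nichols_graded nR) (- xi) gyx gxy.
apply/eqP; rewrite -subr_eq0 addrC -scaleNr.
apply/eqP/(nichols_primitive_eq0 nR gr2) => // X f bf.
rewrite !big_cons big_nil addr0 /=.
rewrite (Delta_linear B _ _ _ bf) !(bilDl bf, bilDr bf) (bilZl bf) (bilZr bf) (Delta_xM bf) (Delta_yM bf).
rewrite (Delta_iota (twist_x_bilinear bf)) (Delta_iota (twist_y_bilinear bf)).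
rewrite /twist_x /twist_y /= ay byy cx dx a1 b1 c1 d1 !mulr1.
rewrite (bilZl bf) (bilNl bf) !(bil0l bf) !scaler0 !addr0 !subr0 !scalerDr.
rewrite scalerN.
lincomb k [:: f (x * y) 1; f (y * x) 1; f x y; f y x; f 1 (x * y); f 1 (y * x)].
all: ring.
Qed.

Lemma x_yX j : x * y ^+ j = xi ^+ j *: (y ^+ j * x).
Proof. by have := qcommute xy_comm 1 j; rewrite !expr1 mul1n. Qed.

Lemma act_b_xX i : act B b (x ^+ i) = 0.
Proof.
have [_ bx _ _] := act_x; have [_ b1 _ _] := act_one.
elim: i => [|i IH] //; by rewrite exprS act_bM IH bx mulr0 mul0r addr0.
Qed.

(** The element b.(y^j x^i) is zero if j = 0 and a multiple of y^(j-1) x^(i+1)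
    otherwise, so x kills it. *)
Lemma x_act_b j i : x * act B b (y ^+ j * x ^+ i) = 0.
Proof.
have [ay byy _ _] := act_y.
elim: j => [|j IH]; first by rewrite mul1r act_b_xX mulr0.
rewrite exprS -mulrA act_bM mulrDr ay byy -scalerAl -scalerAr mulrA xy_comm.
by rewrite -scalerAl -mulrA IH mulr0 !scaler0 add0r mulrA -expr2 x_sqr mul0r.
Qed.

(** The monomials are eigenvectors of d: in the coproduct c (x) b + d (x) d of d,
    the first term would contribute x (b.s) to d.(y s), which is zero by the
    previous lemma. *)
Lemma act_d_monomial j i :
  act B d (y ^+ j * x ^+ i) = ((- xi) ^+ j * (-1) ^+ i) *: (y ^+ j * x ^+ i).
Proof.
have [_ _ cx dx] := act_x; have [_ _ _ d1] := act_one.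
have [_ _ cy dy] := act_y.
elim: j => [|j IH]; last first.
  rewrite exprS -mulrA act_dM cy x_act_b add0r dy IH -scalerAr -scalerAl scalerA.
  by congr (_ *: _); rewrite mulrC mulrA -exprS.
rewrite !expr0 !mul1r; elim: i => [|i IH]; first by rewrite !expr0 scale1r.
by rewrite !exprS act_dM cx mul0r add0r dx IH -scalerAr !mulNr mul1r scaleNr scalerN.
Qed.

Lemma act_d_yX j : act B d (y ^+ j) = (- xi) ^+ j *: y ^+ j.
Proof. by have := act_d_monomial j 0; rewrite !mulr1. Qed.

Lemma act_d_yx : act B d (y * x) = xi *: (y * x).
Proof. by have := act_d_monomial 1 1; rewrite !expr1 mulrN1 opprK. Qed.

Lemma act_c_yx : act B c (y * x) = 0.
Proof.
have [ax _ cx _] := act_x; have [_ _ cy _] := act_y.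
by rewrite act_cM ax cx cy mulr0 addr0 mulrN -expr2 x_sqr oppr0.
Qed.

Lemma act_a_y2 : act B a (y ^+ 2) = - y ^+ 2.
Proof.
have [ay byy cy _] := act_y.
rewrite {1}expr2 act_aM ay byy cy -(expr2 x) x_sqr addr0 -scalerAl -scalerAr scalerA.
by rewrite -!expr2 xi_sqr scaleN1r.
Qed.

Lemma act_c_y2 : act B c (y ^+ 2) = - (1 + xi) *: (y * x).
Proof.
have [ay _ cy dy] := act_y.
rewrite {1}expr2 act_cM ay cy dy -scalerAr xy_comm scalerA -scalerAl -scalerDl.
by rewrite -expr2 xi_sqr opprD.
Qed.

Lemma act_c_y3 : act B c (y ^+ 3) = xi *: (y ^+ 2 * x).
Proof.
have [ay _ cy dy] := act_y.
rewrite exprS act_cM cy act_a_y2 act_c_y2 dy mulrN x_yX xi_sqr scaleN1r opprK.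
rewrite -scalerAl -scalerAr scalerA mulrA -expr2 -{1}[_ * x]scale1r -scalerDl.
congr (_ *: _); ring: xi_sqr.
Qed.

(** * The fourth power of y *)

Lemma Delta_y2 (X : lmodType k) (f : R -> R -> X) : bilinear f ->
  \sum_(p <- Delta (y ^+ 2)) f p.1 p.2
    = f (y ^+ 2) 1 + (1 - xi) *: f y y + gam *: f x x + f 1 (y ^+ 2).
Proof.
move=> bf; have [_ _ c1 d1] := act_one; have [_ _ cy dy] := act_y.
rewrite {1}expr2 (Delta_yM bf) (Delta_iota (twist_y_bilinear bf)) /twist_y.
rewrite c1 d1 cy dy !mulr1 -expr2 (bilZl bf) (bil0l bf) scaler0 addr0.
lincomb k [:: f (y ^+ 2) 1; f y y; f x x; f 1 (y ^+ 2)]; ring.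
Qed.

Local Notation kap := (2%:R^-1 * (1 + xi)).

Lemma Delta_y3 (X : lmodType k) (f : R -> R -> X) : bilinear f ->
  \sum_(p <- Delta (y ^+ 3)) f p.1 p.2
    = f (y ^+ 3) 1 - xi *: f (y ^+ 2) y + kap *: f (y * x) x
      - xi *: f y (y ^+ 2) - kap *: f x (y * x) + f 1 (y ^+ 3).
Proof.
move=> bf; have [_ _ c1 d1] := act_one; have [_ _ cy dy] := act_y.
have [_ _ cx dx] := act_x; have two := two_neq0; have xi2 := xi_sqr.
rewrite exprS (Delta_yM bf) (Delta_y2 (twist_y_bilinear bf)) /twist_y.
rewrite c1 d1 cy dy cx dx act_d_yX act_c_y2 !mulr1 -exprS -expr2 xy_comm.
rewrite !(bilZl bf) !(bilNl bf) !(bilZr bf) !(bil0l bf) !scaler0 !addr0.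
rewrite !scalerDr !scalerN !scalerA.
lincomb k [:: f (y ^+ 3) 1; f (y ^+ 2) y; f (y * x) x; f y (y ^+ 2);
              f x (y * x); f 1 (y ^+ 3)]; field: xi2; rewrite ?two_neq0 //.
Qed.

(** Multiplying Delta(y^3) by y produces mixed terms on the six tensors
    y^3 (x) y, y^2 (x) y^2, yx (x) yx, y^2 x (x) x, y (x) y^3 and x (x) y^2 x, and
    each of their coefficients vanishes because xi^2 = -1. *)
Lemma y_pow4 : y ^+ 4 = 0.
Proof.
have [_ _ c1 d1] := act_one; have [_ _ cy dy] := act_y.
have [_ _ cx dx] := act_x; have two := two_neq0; have xi2 := xi_sqr.
have gy := gr_iota e2.
have gr4 : gr 4 (y ^+ 4) := gr_mul (nichols_graded nR) gy
  (gr_mul (nichols_graded nR) gy (gr_mul (nichols_graded nR) gy gy)).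
apply: (nichols_primitive_eq0 nR gr4) => // X f bf.
rewrite !big_cons big_nil addr0 /=.
rewrite exprS (Delta_yM bf) (Delta_y3 (twist_y_bilinear bf)) /twist_y.
rewrite c1 d1 cy dy cx dx !act_d_yX act_d_yx act_c_y2 act_c_y3 act_c_yx !mulr1.
rewrite -!exprS -expr2 (mulrA y) -expr2 xy_comm x_yX xi2.
rewrite !(bilZl bf) !(bilNl bf) !(bilZr bf) !(bil0l bf).
rewrite !scaler0 !addr0 !scalerDr !scalerN !scalerA !opprD !opprK.
lincomb k [:: f (y ^+ 4) 1; f (y ^+ 3) y; f (y ^+ 2) (y ^+ 2); f (y * x) (y * x);
  f (y ^+ 2 * x) x; f y (y ^+ 3); f x (y ^+ 2 * x); f 1 (y ^+ 4)]; field: xi2; rewrite ?two_neq0 //.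
Qed.

(** * The monomials form a basis *)

Lemma degree_one_functional : exists phi : {scalar R},
  [/\ phi x = 0, phi y = 1 & forall n r, gr n r -> n != 1%N -> phi r = 0].
Proof.
have [pr [prK pr0]] := degree_one_projection (nichols_graded nR)
  (@nichols_iota_inj _ _ _ _ _ _ _ _ _ nR) (nichols_gr1 nR).
have [co [_ coB]] := basis_coordinates (V3_basis isV).
pose phi r := co (pr r) 0 1.
have phi_lin : scalar phi by move=> e r s; rewrite /phi !linearP !mxE.
pose L := GRing.isLinear.Build k R k _ phi phi_lin.
exists (HB.pack_for {scalar R} phi L); split=> [||n r grr n1] /=; rewrite /phi.
- by rewrite prK (coB 0) mxE.
- by rewrite prK (coB 1) mxE.
- by rewrite (pr0 n) // linear0 mxE.
Qed.

Lemma iota_e1_neq0 : x != 0.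
Proof.
have [co [_ coB]] := basis_coordinates (V3_basis isV).
apply/eqP=> x0; have e0 : e1 = 0.
  by apply: (nichols_iota_inj nR); rewrite x0 linear0.
have /matrixP/(_ 0 0)/eqP := coB 0.
by rewrite [tnth _ 0]e0 linear0 !mxE eqxx /= eq_sym oner_eq0.
Qed.

Lemma monomials_span (r : R) : exists e : 'I_8 -> k,
  r = \sum_i e i *: tnth (qmonomials x y) i.
Proof.
pose S (r : R) := exists e : 'I_8 -> k, r = \sum_i e i *: tnth (qmonomials x y) i.
have S_lin u r1 r2 : S r1 -> S r2 -> S (u *: r1 + r2).
  move=> [e1' ->] [e2' ->]; exists (fun i => u * e1' i + e2' i).
  rewrite scaler_sumr -big_split; apply: eq_bigr => i _.
  by rewrite scalerDl scalerA.
have S0 : S 0 by exists (fun=> 0); rewrite big1 // => i _; rewrite scale0r.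
have SZ u r1 : S r1 -> S (u *: r1) by move=> h; rewrite -[_ *: _]addr0; apply: S_lin.
have SD r1 r2 : S r1 -> S r2 -> S (r1 + r2).
  by move=> h1 h2; rewrite -[r1]scale1r; apply: S_lin.
have Smon j i : S (y ^+ j * x ^+ i).
  have [[l <- <-]|h0] := qmonomial_cases j i; last first.
    by rewrite (qmonomial_eq0 x_sqr y_pow4 h0).
  exists (fun m => (m == l)%:R); rewrite (bigD1 l) //= eqxx scale1r tnth_mktuple.
  by rewrite big1 ?addr0 // => m /negbTE->; rewrite scale0r.
have S_sum (F : 'I_8 -> R) : (forall i, S (F i)) -> S (\sum_i F i).
  by move=> h; apply: big_ind.
apply: (nichols_generated nR (S := S)).
- by have := Smon 0%N 0%N; rewrite !expr0 mulr1.
- exact: S_lin.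
- move=> s t [u ->] [v ->]; rewrite mulr_suml; apply: (S_sum) => i.
  rewrite mulr_sumr; apply: (S_sum) => j; rewrite -scalerAl -scalerAr; do 2!apply: (SZ).
  by rewrite !tnth_mktuple (qmonomialM xy_comm); apply: SZ.
- move=> s /(nichols_gr1 nR)[v ->]; have [u [-> _]] := V3_basis isV v.
  rewrite linear_sum !big_ord_recl big_ord0 addr0 !linearZ.
  apply: SD; apply: (SZ); first by have := Smon 0%N 1%N; rewrite expr0 mul1r.
  by have := Smon 1%N 0%N; rewrite expr0 mulr1.
Qed.

(** The quantum integer [n] at q. *)
Definition qint (q : k) n := \sum_(l < n) q ^+ l.

Lemma qint_neq0 n : (n < 3)%N -> qint (- xi) n.+1 != 0.
Proof.
have xi2 := xi_sqr; have two := two_neq0.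
have xi0 : xi != 0 by apply/eqP=> h; move/eqP: xi2; rewrite h expr0n eq_sym oppr_eq0 oner_eq0.
rewrite /qint; case: n => [|[|[|n]]] // _; rewrite !big_ord_recr big_ord0 /=.
- by rewrite add0r oner_neq0.
(* [2] = 1 - xi, and xi = 1 would give 1 = xi^2 = -1. *)
- rewrite add0r expr0 expr1 subr_eq0; apply: contra_neq two => xi1.
  by move: xi2; rewrite -xi1 expr1n => h; rewrite [_%:R]mulrS {1}h addNr.
(* [3] = 1 - xi + xi^2 = - xi. *)
- by rewrite add0r expr0 expr1 sqrrN xi2 addrAC subrr add0r oppr_eq0.
Qed.

(** The hypotheses on phi say that it is the coefficient of y in the degree-one
    part. *)
Section SkewDerivation.
Variable phi : {scalar R}.
Hypothesis phi_x : phi x = 0.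
Hypothesis phi_y : phi y = 1.
Hypothesis phi_gr : forall n r, gr n r -> n != 1%N -> phi r = 0.

Definition skew_der (r : R) : R := \sum_(p <- Delta r) phi p.2 *: p.1.

Let f (p q : R) : R := phi q *: p.
Let bf : bilinear f.
Proof.
split=> [q | p] e u v /=; rewrite /f.
  by rewrite scalerDr !scalerA mulrC.
by rewrite linearP scalerDl scalerA.
Qed.

Lemma skew_der_linear e u v :
  skew_der (e *: u + v) = e *: skew_der u + skew_der v.
Proof. exact: (Delta_linear B e u v bf). Qed.

HB.instance Definition _ :=
  GRing.isLinear.Build k R R _ skew_der skew_der_linear.

Lemma phi_one : phi 1 = 0.
Proof. exact: (phi_gr (gr_one (nichols_graded nR))). Qed.

(** A product v r has a part of degree one only through the scalar part of r,
    which is the counit of r. *)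
Lemma phi_iotaM v r : phi (iota v * r) = counit (bh_coalgebra B) r * phi (iota v).
Proof.
have [N [h [grh ->]]] := gr_span (nichols_graded nR) r.
rewrite mulr_sumr !linear_sum mulr_suml; apply: eq_bigr => n _ /=.
have grn := grh n; have [n0|n0] := posnP n.
  rewrite n0 in grn *; have [e ->] := (nichols_gr0 nR _).1 grn.
  by rewrite -scalerAr mulr1 !linearZ /= bh_counit1 mulr1.
rewrite (gr_counit (nichols_graded nR) n0 grn) mul0r.
apply: (phi_gr (gr_mul (nichols_graded nR) (gr_iota v) grn)).
by rewrite add1n eqSS -lt0n.
Qed.

(** In Delta(y s), the terms y s_1 (x) s_2 give y D(s), the terms
    d.s_1 (x) y s_2 give d.s by the counit axiom, and the terms with x s_2 on the
    right die because phi(x) = 0. *)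
Lemma skew_der_yM s : skew_der (y * s) = y * skew_der s + act B d s.
Proof.
have -> : act B d s
    = \sum_(p <- Delta s) counit (bh_coalgebra B) p.2 *: act B d p.1.
  rewrite -{1}(counit_r (bh_coalgebra B) s).
  elim: (Delta s) => [|p l IH]; first by rewrite !big_nil act0r.
  by rewrite !big_cons act_linr IH.
rewrite /skew_der (Delta_yM bf) mulr_sumr -big_split; apply: eq_bigr => p _ /=.
rewrite /twist_y /f !phi_iotaM phi_x phi_y mulr0 mulr1 scale0r scaler0 addr0.
by rewrite scalerAr.
Qed.

Lemma skew_der_xX i : (i < 2)%N -> skew_der (x ^+ i) = 0.
Proof.
case: i => [|[|//]] _; rewrite /skew_der.
  by rewrite (bh_cmul1 B bf) !big_cons big_nil /f phi_one scale0r addr0.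
by rewrite (Delta_iota bf) /f phi_x phi_one !scale0r addr0.
Qed.

Lemma skew_der_monomial j i : (i < 2)%N ->
  skew_der (y ^+ j.+1 * x ^+ i)
    = ((-1) ^+ i * qint (- xi) j.+1) *: (y ^+ j * x ^+ i).
Proof.
move=> i2; elim: j => [|j IH]; rewrite exprS -mulrA skew_der_yM act_d_monomial /qint.
  by rewrite !expr0 !mul1r skew_der_xX // mulr0 add0r big_ord_recr big_ord0 /= add0r expr0 mulr1.
rewrite IH -scalerAr mulrA -exprS -scalerDl; congr (_ *: _).
by rewrite [in RHS]big_ord_recr /= mulrDr [(- xi) ^+ _ * _]mulrC.
Qed.

(** Applying D removes the row j = 0 and lowers the other exponents of y by
    one, so induction kills all coefficients with j > 0. In the remaining row,
    the counit separates 1 from x. *)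
Lemma monomials_free n (u : nat -> nat -> k) : (n <= 4)%N ->
  \sum_(j < n) \sum_(i < 2) u j i *: (y ^+ j * x ^+ i) = 0 ->
  forall j i, (j < n)%N -> (i < 2)%N -> u j i = 0.
Proof.
elim: n u => [|n IH] u n4 //; rewrite big_ord_recl /= => s0.
have uS j i : (j < n)%N -> (i < 2)%N -> u j.+1 i = 0.
  move=> jn i2.
  have s1 : \sum_(j < n) \sum_(i < 2)
      (u j.+1 i * ((-1) ^+ i * qint (- xi) j.+1)) *: (y ^+ j * x ^+ i) = 0.
    have := congr1 skew_der s0; rewrite linear0 linearD !linear_sum.
    rewrite [X in X + _]big1 => [|m _]; last first.
      by rewrite linearZ mul1r /= skew_der_xX ?scaler0.
    rewrite add0r => h; rewrite -[RHS]h; apply: eq_bigr => m _.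
    rewrite linear_sum; apply: eq_bigr => l _.
    by rewrite linearZ /= skew_der_monomial // scalerA.
  have := IH (fun j i => u j.+1 i * ((-1) ^+ i * qint (- xi) j.+1)) (ltnW n4) s1 j i jn i2.
  move/eqP; rewrite mulf_eq0 => /orP[/eqP//|].
  by rewrite mulf_eq0 signr_eq0 (negbTE (qint_neq0 (leq_trans jn n4))).
have := s0; rewrite [X in _ + X]big1 => [|j _]; last first.
  by rewrite big1 // => i _; rewrite uS // scale0r.
rewrite addr0 !big_ord_recl big_ord0 addr0 !mul1r /= => h0.
have u00 : u 0 0 = 0.
  have := congr1 (counit (bh_coalgebra B)) h0.
  rewrite linearD !linearZ /= linear0 bh_counit1.
  by rewrite (gr_counit (nichols_graded nR) _ (gr_iota e1)) // mulr1 mulr0 addr0.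
have u01 : u 0 1 = 0.
  move: h0; rewrite u00 scale0r add0r => /eqP; rewrite scaler_eq0.
  by rewrite (negbTE iota_e1_neq0) orbF => /eqP.
case=> [|j] [|[|//]] // jn _; exact: uS.
Qed.
End SkewDerivation.

Lemma monomials_basis : is_basis (qmonomials x y).
Proof.
move=> r; have [e re] := monomials_span r.
exists (\row_i e i); split; first by rewrite re; apply: eq_bigr => i _; rewrite mxE.
have [phi [phi_x phi_y phi_gr]] := degree_one_functional.
move=> g rg; apply/rowP=> i; rewrite mxE; apply/eqP; rewrite -subr_eq0; apply/eqP.
(* The monomial y^j x^l has index 2 j + l. *)
pose u j l := e (inord (j * 2 + l)) - g 0 (inord (j * 2 + l)).
have u_divmod (m : 'I_8) : u (m %/ 2)%N (m %% 2)%N = e m - g 0 m.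
  by rewrite /u -divn_eq inord_val.
have u_sum : \sum_(j < 4) \sum_(l < 2) u j l *: (y ^+ j * x ^+ l) = 0.
  rewrite -(sum_divmod2 (fun j l => u j l *: (y ^+ j * x ^+ l)) 4).
  rewrite -[RHS](subrr r) {1}re rg -sumrB; apply: eq_bigr => m _.
  by rewrite u_divmod scalerBl tnth_mktuple.
rewrite -u_divmod.
apply: (monomials_free phi_x phi_y phi_gr (n := 4) isT u_sum).
  by rewrite ltn_divLR.
by rewrite ltn_mod.
Qed.
End NicholsV23.

Theorem proposition4p9 (k : closedFieldType) (char0 : [pchar k] =i pred0)
    (xi : k) (xi_prim : 4.-primitive_root xi)
    (K : algType k) (H : hopf_algebra K) (a b c d : K)
    (isK : is_calK xi H a b c d)
    (V : lmodType k) (YV : yetter_drinfeld H V) (e1 e2 : V)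
    (isV : is_V3 xi a b c d (2 : 'Z_4) YV e1 e2)
    (R : algType k) (B : braided_hopf H R)
    (gr : nat -> R -> Prop) (iota : {linear V -> R})
    (nicholsR : nichols_algebra YV B gr iota) :
  presented (@nichols_V23_rel k xi) [tuple iota e1; iota e2] /\ has_dim R 8.
Proof.
have x2 := x_sqr xi_prim isK isV nicholsR.
have xy := xy_comm xi_prim isK isV nicholsR.
have y4 := y_pow4 char0 xi_prim isK isV nicholsR.
have basis := monomials_basis char0 xi_prim isK isV nicholsR.
split; last by exists (qmonomials (iota e1) (iota e2)).
apply: quantum_plane_presented; last exact basis.
split; [exact x2 | | exact y4].
by rewrite [tnth _ 0 * _]xy subrr.
Qed.
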